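(* Let $M$ and $N$ be two quasianalytic weight sequences and assume $\sup_{k\in\mathbb N_{>0}}n_k^{1/k}=+\infty$ (Roumieu case) resp. $\lim_{k\to+\infty}n_k^{1/k}=+\infty$ (Beurling case). Then $\Lambda^r_{[N]}\setminus j^\infty(\mathcal E^{0,r}_{\{M\}})$ is lineable in $\Lambda^r_{[N]}$ (and hence so is $\Lambda^r_{[N]}\setminus j^\infty(\mathcal E^{0,r}_{(M)})$).
   Context: For a sequence $M=(M_p)_{p\in\mathbb N}$ of positive reals write $m_p:=M_p/p!$ (and $n_p:=N_p/p!$). $M$ is a weight sequence if $1=M_0\le M_1$, $M_p^2\le M_{p-1}M_{p+1}$ for all $p\ge1$, and $\liminf_{p\to\infty}m_p^{1/p}>0$; it is quasianalytic if $\sum_{p\ge1}M_{p-1}/M_p=+\infty$. For $U\subseteq\mathbb R^r$ open, $K\subseteq U$ compact, $h>0$: $\|f\|^M_{K,h}:=\sup_{\alpha\in\mathbb N^r,x\in K}|\partial^\alpha f(x)|/(h^{|\alpha|}M_{|\alpha|})$. $\mathcal E_{\{M\}}(U)$ consists of smooth $f$ such that for every compact $K\subseteq U$ there exists $h>0$ with $\|f\|^M_{K,h}<\infty$; $\mathcal E_{(M)}(U)$: for every compact $K$ and every $h>0$. $\mathcal E^{0,r}_{\{M\}}$, $\mathcal E^{0,r}_{(M)}$ are the spaces of germs at $0\in\mathbb R^r$ of functions in the respective class on some cube $(-1/k,1/k)^r$. For $\mathbf b=(b_\alpha)_{\alpha\in\mathbb N^r}$ and $h>0$: $|\mathbf b|^N_h:=\sup_\alpha|b_\alpha|/(h^{|\alpha|}n_{|\alpha|})$;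 $\Lambda^r_{\{N\}}:=\{\mathbf b:\exists h>0,|\mathbf b|^N_h<\infty\}$, $\Lambda^r_{(N)}:=\{\mathbf b:\forall h>0,|\mathbf b|^N_h<\infty\}$. The Borel map is $j^\infty(f)=(\partial^\alpha f(0)/|\alpha|!)_{\alpha\in\mathbb N^r}$. The notation $[\cdot]$ means either $\{\cdot\}$ throughout (Roumieu) or $(\cdot)$ throughout (Beurling). A subset $L$ of a vector space $X$ is lineable if $L\cup\{0\}$ contains an infinite-dimensional vector subspace. *)

(* Defs.v *)
From Stdlib Require Import Reals Lra Lia Arith.
Open Scope R_scope.

Definition msmall (M : nat -> R) (p : nat) : R := M p / INR (fact p).

Definition mroot (M : nat -> R) (p : nat) : R := Rpower (msmall M p) (/ INR p).

Definition weight_sequence (M : nat -> R) : Prop :=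
  (forall p, 0 < M p) /\
  M 0%nat = 1 /\ M 0%nat <= M 1%nat /\
  (forall p, (1 <= p)%nat -> (M p) ^ 2 <= M (p - 1)%nat * M (p + 1)%nat) /\
  (exists c, 0 < c /\ exists p0, forall p, (p0 <= p)%nat -> (1 <= p)%nat ->
        c <= mroot M p).

Definition quasianalytic (M : nat -> R) : Prop :=
  forall B : R, exists n : nat,
    B < sum_f_R0 (fun k => M k / M (S k)) n.

(* A point of R^r is a function x : nat -> R whose coordinates >= r vanish. *)
Definition upd (x : nat -> R) (i : nat) (t : R) : nat -> R :=
  fun j => if Nat.eqb j i then t else x j.

Definition zero_pt : nat -> R := fun _ => 0.

Definition open_cube (r : nat) (rho : R) (x : nat -> R) : Prop :=
  forall i, ((i < r)%nat -> Rabs (x i) < rho) /\ ((r <= i)%nat -> x i = 0).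
Definition closed_cube (r : nat) (rho : R) (x : nat -> R) : Prop :=
  forall i, ((i < r)%nat -> Rabs (x i) <= rho) /\ ((r <= i)%nat -> x i = 0).

Definition valid_mi (r : nat) (a : nat -> nat) : Prop :=
  forall i, (r <= i)%nat -> a i = 0%nat.

Definition mindex (r : nat) : Type := {a : nat -> nat | valid_mi r a}.

Fixpoint nsum (a : nat -> nat) (n : nat) : nat :=
  match n with O => O | S n' => (nsum a n' + a n')%nat end.

Definition mabs (r : nat) (a : nat -> nat) : nat := nsum a r.

Definition incr (a : nat -> nat) (i : nat) : nat -> nat :=
  fun j => if Nat.eqb j i then S (a j) else a j.

(** * Smooth functions on an open cube, with their partial derivatives.
    [D a] is the partial derivative d^a f; [D (fun _ => 0)] is f itself.
    D is required to consist of continuous functions on the cube such that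
    d/dx_i (D a) = D (a + e_i) for all i < r, i.e. f is C^oo with
    partial derivatives D. *)
Definition smooth_derivs (r : nat) (rho : R) (D : (nat -> nat) -> (nat -> R) -> R)
  : Prop :=
  (forall a, valid_mi r a -> forall i, (i < r)%nat -> forall x, open_cube r rho x ->
      derivable_pt_lim (fun t => D a (upd x i t)) (x i) (D (incr a i) x)) /\
  (forall a, valid_mi r a -> forall x, open_cube r rho x ->
      forall eps, 0 < eps -> exists delta, 0 < delta /\
        forall y, open_cube r rho y ->
          (forall i, (i < r)%nat -> Rabs (y i - x i) < delta) ->
          Rabs (D a y - D a x) < eps).

(** [roum = true]: Roumieu case {.}; [roum = false]: Beurling case (.). *)
Definition quant_h (roum : bool) (P : R -> Prop) : Prop :=
  if roum then exists h, 0 < h /\ P h else forall h, 0 < h -> P h.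

(* Germs at 0 of functions in E_[M]: given by f = D 0 on some cube
   (-1/k,1/k)^r, smooth there, with ||f||^M_{K,h} finite for every compact
   K of the cube (K ranging over the exhausting closed subcubes [-rho,rho]^r). *)
Definition germ_class (r : nat) (M : nat -> R) (roum : bool)
  (k : nat) (D : (nat -> nat) -> (nat -> R) -> R) : Prop :=
  (1 <= k)%nat /\ smooth_derivs r (/ INR k) D /\
  forall rho, 0 < rho < / INR k ->
    quant_h roum (fun h => exists C, forall a, valid_mi r a ->
      forall x, closed_cube r rho x ->
        Rabs (D a x) <= C * (h ^ (mabs r a) * M (mabs r a))).

Definition jet (r : nat) (D : (nat -> nat) -> (nat -> R) -> R) : mindex r -> R :=
  fun al => D (proj1_sig al) zero_pt / INR (fact (mabs r (proj1_sig al))).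

Definition in_jet_image (r : nat) (M : nat -> R) (roum : bool) (b : mindex r -> R)
  : Prop :=
  exists k D, germ_class r M roum k D /\ b = jet r D.

Definition Lambda (r : nat) (N : nat -> R) (roum : bool) (b : mindex r -> R) : Prop :=
  quant_h roum (fun h => exists C, forall al : mindex r,
    Rabs (b al) <= C * (h ^ (mabs r (proj1_sig al)) * msmall N (mabs r (proj1_sig al)))).

Definition vzero {T : Type} : T -> R := fun _ => 0.

Definition is_subspace {T : Type} (V : (T -> R) -> Prop) : Prop :=
  V vzero /\
  (forall u v, V u -> V v -> V (fun t => u t + v t)) /\
  (forall c u, V u -> V (fun t => c * u t)).

Fixpoint lincomb {T : Type} (c : nat -> R) (v : nat -> T -> R) (n : nat) : T -> R :=
  match n with
  | O => vzero
  | S n' => fun t => lincomb c v n' t + c n' * v n' t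
  end.

Definition lin_indep {T : Type} (v : nat -> T -> R) (n : nat) : Prop :=
  forall c : nat -> R, lincomb c v n = vzero -> forall i, (i < n)%nat -> c i = 0.

Definition infinite_dim {T : Type} (V : (T -> R) -> Prop) : Prop :=
  forall n : nat, exists v : nat -> T -> R,
    (forall i, (i < n)%nat -> V (v i)) /\ lin_indep v n.

Definition lineable {T : Type} (L : (T -> R) -> Prop) : Prop :=
  exists V : (T -> R) -> Prop,
    is_subspace V /\ infinite_dim V /\ (forall v, V v -> L v \/ v = vzero).

(* Main.v *)
(** Restricting a germ to the first coordinate axis reduces everything to one
    variable.  Let [w k] be [n_k] (Roumieu) or [sqrt n_k] (Beurling), and
    consider the jets supported on the multi-indices [k e_1] with values
    [sum_i c_i (2^i)^k w k], where [c] has finite support.  They belong to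
    [Lambda], and a nonzero one has eventually constant sign, since it is
    asymptotic to its term with the largest exponential.

    Such a jet cannot come from a quasianalytic germ.  Bang's argument for the
    Denjoy-Carleman theorem, run with the negative parts of the derivatives
    only, shows that a function all of whose derivatives are nonnegative at an
    endpoint of an interval keeps nonnegative derivatives on the interval.
    Applied to the derivatives of order [>= K], it makes Taylor's formula bound
    the jet geometrically, whereas its leading term, at least a multiple of
    [w k], is not bounded by any [C * A^k]. *)

Require Import Defs.
From Stdlib Require Import Reals Arith Lra Lia Classical FunctionalExtensionality.
From Coquelicot Require Import Coquelicot.
Open Scope R_scope.

(** * Domination of sequences *)

Definition big_O (a b : nat -> R) : Prop :=
  exists C, 0 <= C /\ forall k, Rabs (a k) <= C * b k.

Lemma big_O_of_eventually (a b : nat -> R) (C : R) :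
  (forall k, 0 < b k) -> eventually (fun k => Rabs (a k) <= C * b k) -> big_O a b.
Proof.
intros b_pos [K a_le]; revert C a_le; induction K as [|K IH]; intros C a_le.
- exists (Rabs C); split; [apply Rabs_pos|]; intros k.
  apply Rle_trans with (1 := a_le k ltac:(lia)).
  apply Rmult_le_compat_r; [left; apply b_pos|apply Rle_abs].
- apply (IH (Rmax C (Rabs (a K) / b K))); intros k K_le_k.
  destruct (Nat.eq_dec k K) as [->|k_neq_K].
  + apply Rle_div_l; [apply b_pos|apply Rmax_r].
  + apply Rle_trans with (1 := a_le k ltac:(lia)).
    apply Rmult_le_compat_r; [left; apply b_pos|apply Rmax_l].
Qed.

Lemma big_O_trans (a b c : nat -> R) : big_O a b -> big_O b c -> big_O a c.
Proof.
intros [C [C_ge0 a_le]] [C' [C'_ge0 b_le]]; exists (C * C').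
split; [now apply Rmult_le_pos|]; intros k.
apply Rle_trans with (1 := a_le k); rewrite Rmult_assoc.
apply Rmult_le_compat_l; [exact C_ge0|].
apply Rle_trans with (1 := Rle_abs _), b_le.
Qed.

Lemma big_O_mult (a b a' b' : nat -> R) :
  big_O a b -> big_O a' b' -> big_O (fun k => a k * a' k) (fun k => b k * b' k).
Proof.
intros [C [C_ge0 a_le]] [C' [C'_ge0 a'_le]]; exists (C * C').
split; [now apply Rmult_le_pos|]; intros k; rewrite Rabs_mult.
replace (C * C' * (b k * b' k)) with (C * b k * (C' * b' k)) by ring.
apply Rmult_le_compat; auto using Rabs_pos.
Qed.

Lemma big_O_refl (a : nat -> R) : (forall k, 0 <= a k) -> big_O a a.
Proof.
intros a_ge0; exists 1; split; [lra|]; intros k.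
rewrite Rabs_pos_eq by apply a_ge0; lra.
Qed.

Lemma big_O_sqrt (a b : nat -> R) :
  big_O (fun k => a k ^ 2) b -> big_O a (fun k => sqrt (b k)).
Proof.
intros [C [C_ge0 a_sqr_le]]; exists (sqrt C); split; [apply sqrt_pos|]; intros k.
rewrite <- sqrt_mult_alt, <- (sqrt_pow2 (Rabs (a k))) by auto using Rabs_pos.
apply sqrt_le_1_alt; rewrite RPow_abs; apply a_sqr_le.
Qed.

Lemma is_domin_big_O (a b : nat -> R) :
  (forall k, 0 < b k) -> is_domin eventually b a -> big_O a b.
Proof.
intros b_pos dom; apply (big_O_of_eventually a b 1 b_pos).
apply filter_imp with (2 := dom (mkposreal 1 Rlt_0_1)); intros k a_le.
rewrite <- (Rabs_pos_eq (b k)) by (left; apply b_pos); exact a_le.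
Qed.

Definition asymptotic_scale (u : nat -> nat -> R) : Prop :=
  (forall i k, 0 < u i k) /\ forall i, is_domin eventually (u (S i)) (u i).

Lemma asymptotic_scale_domin_lincomb (u : nat -> nat -> R) (c : nat -> R) (n : nat) :
  asymptotic_scale u -> is_domin eventually (u n) (lincomb c u n).
Proof.
intros [_ u_domin]; induction n as [|n IH].
- intros eps; exists 0%nat; intros k _; simpl; unfold vzero.
  change (Rabs 0 <= eps * Rabs (u 0%nat k)); rewrite Rabs_R0.
  apply Rmult_le_pos; [left; apply cond_pos|apply Rabs_pos].
- apply (domin_plus (u (S n)) (lincomb c u n) (fun k => scal (c n) (u n k))).
  + apply domin_trans with (1 := u_domin n), IH.
  + apply (domin_scal_r (u (S n)) (u n)), u_domin.
Qed.

Lemma asymptotic_scale_equiv_lincomb (u : nat -> nat -> R) (c : nat -> R) (n : nat) :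
  asymptotic_scale u -> (exists i, (i < n)%nat /\ c i <> 0) ->
  exists i, c i <> 0 /\ is_equiv eventually (lincomb c u n) (fun k => c i * u i k).
Proof.
intros u_scale; induction n as [|n IH]; intros [i [i_lt_n ci]]; [lia|].
destruct (Req_dec (c n) 0) as [cn|cn].
- destruct IH as [j [cj equiv_j]].
  { exists i; split; [|exact ci].
    destruct (Nat.eq_dec i n) as [->|]; [contradiction|lia]. }
  exists j; split; [exact cj|].
  replace (lincomb c u (S n)) with (lincomb c u n); [exact equiv_j|].
  apply functional_extensionality; intros k; simpl; rewrite cn; ring.
- exists n; split; [exact cn|].
  apply equiv_carac_1 with (o := lincomb c u n).
  + intros k; apply Rplus_comm.
  + apply (domin_scal_l (u n) (lincomb c u n) (c n)).
    * exists (/ c n); now apply Rinv_l.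
    * now apply asymptotic_scale_domin_lincomb.
Qed.

Lemma is_equiv_eventual_sign (f v : nat -> R) (c : R) :
  (forall k, 0 < v k) -> c <> 0 -> is_equiv eventually f (fun k => c * v k) ->
  eventually (fun k => Rabs c / 2 * v k <= sign c * f k).
Proof.
intros v_pos c_neq0 equiv_f.
assert (half_pos : 0 < / 2) by lra.
apply filter_imp with (2 := equiv_f (mkposreal _ half_pos)); intros k f_close.
change (Rabs (c * v k - f k) <= / 2 * Rabs (c * v k)) in f_close.
rewrite Rabs_mult, (Rabs_pos_eq (v k)) in f_close by (left; apply v_pos).
apply Rabs_le_between in f_close.
destruct (Rdichotomy c 0 c_neq0) as [c_neg|c_pos].
- rewrite sign_eq_m1 by exact c_neg; rewrite Rabs_left in * by exact c_neg; lra.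
- rewrite sign_eq_1 by exact c_pos; rewrite Rabs_pos_eq in * by lra; lra.
Qed.

Definition geometric_scale (w : nat -> R) (i k : nat) : R := (2 ^ i) ^ k * w k.

Lemma geometric_scale_pos (w : nat -> R) (i k : nat) :
  (forall k, 0 < w k) -> 0 < geometric_scale w i k.
Proof.
intros w_pos; apply Rmult_lt_0_compat; [apply pow_lt, pow_lt; lra|apply w_pos].
Qed.

Lemma geometric_scale_asymptotic (w : nat -> R) :
  (forall k, 0 < w k) -> asymptotic_scale (geometric_scale w).
Proof.
intros w_pos; split; [intros i k; now apply geometric_scale_pos|]; intros i eps.
destruct (is_lim_seq_geom_p 2 ltac:(lra) (fun x => / eps < x)) as [K pow_large].
{ now exists (/ eps). }
exists K; intros k K_le_k; specialize (pow_large k K_le_k).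
change (Rabs (geometric_scale w i k) <= eps * Rabs (geometric_scale w (S i) k)).
rewrite !Rabs_pos_eq by (left; now apply geometric_scale_pos).
replace (geometric_scale w (S i) k) with (2 ^ k * geometric_scale w i k)
  by (unfold geometric_scale; simpl; rewrite Rpow_mult_distr; ring).
assert (eps_pos := cond_pos eps).
apply Rmult_lt_compat_l with (r := eps) in pow_large; [|exact eps_pos].
rewrite Rinv_r in pow_large by lra.
assert (scale_pos := geometric_scale_pos w i k w_pos); nra.
Qed.

Lemma geometric_scale_not_big_O_pow (w : nat -> R) (i : nat) (A : R) :
  (forall k, 0 < w k) -> ~ big_O w (pow A) -> ~ big_O (geometric_scale w i) (pow A).
Proof.
intros w_pos w_large scale_O; apply w_large.
apply big_O_trans with (2 := scale_O).
exists 1; split; [lra|]; intros k; unfold geometric_scale.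
assert (1 <= (2 ^ i) ^ k) by (apply pow_R1_Rle, pow_R1_Rle; lra).
assert (wk := w_pos k); rewrite Rabs_pos_eq by lra; nra.
Qed.

(** * Towers of derivatives *)

Definition derivative_tower (g : nat -> R -> R) (a b : R) : Prop :=
  forall n t, a <= t <= b -> derivable_pt_lim (g n) t (g (S n) t).

Lemma derivative_tower_subinterval (g : nat -> R -> R) (a b x y : R) :
  a <= x -> y <= b -> derivative_tower g a b -> derivative_tower g x y.
Proof. intros ax yb g_tower n t t_in; apply g_tower; lra. Qed.

Lemma derivative_tower_shift (g : nat -> R -> R) (a b : R) (K : nat) :
  derivative_tower g a b -> derivative_tower (fun n => g (n + K)%nat) a b.
Proof. intros g_tower n t t_in; now apply (g_tower (n + K)%nat). Qed.

Lemma derivative_tower_scal (g : nat -> R -> R) (a b s : R) :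
  derivative_tower g a b -> derivative_tower (fun n t => s * g n t) a b.
Proof. intros g_tower n t t_in; now apply (derivable_pt_lim_scal (g n)), g_tower. Qed.

Lemma derivable_pt_lim_nonneg_le (f f' : R -> R) (a b : R) :
  a <= b ->
  (forall t, a <= t <= b -> derivable_pt_lim f t (f' t)) ->
  (forall t, a <= t <= b -> 0 <= f' t) -> f a <= f b.
Proof.
intros [ab| ->] f_deriv f'_ge0; [|lra].
destruct (MVT_cor2 f f' a b ab f_deriv) as [c [mean_value c_ab]].
assert (0 <= f' c * (b - a)) by (apply Rmult_le_pos; [apply f'_ge0|]; lra).
lra.
Qed.

Lemma taylor_term_le (n : nat) (g : nat -> R -> R) (a b : R) :
  derivative_tower g a b ->
  (forall k t, a <= t <= b -> 0 <= g k t) ->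
  forall t, a <= t <= b -> g n a / INR (fact n) * (t - a) ^ n <= g 0%nat t.
Proof.
revert g; induction n as [|n IH]; intros g g_tower g_ge0 t t_in.
- simpl; replace (g 0%nat a / 1 * 1) with (g 0%nat a) by field.
  apply derivable_pt_lim_nonneg_le with (f' := g 1%nat); [lra| |];
    intros u u_in; [apply g_tower|apply g_ge0]; lra.
- set (c := g (S n) a / INR (fact (S n))).
  assert (remainder_incr :
    g 0%nat a - c * (a - a) ^ S n <= g 0%nat t - c * (t - a) ^ S n).
  { apply derivable_pt_lim_nonneg_le with
      (f := fun u => g 0%nat u - c * (u - a) ^ S n)
      (f' := fun u => g 1%nat u - g (S n) a / INR (fact n) * (u - a) ^ n); [lra| |];
      intros u u_in.
    - apply (derivable_pt_lim_minus (g 0%nat)); [apply g_tower; lra|].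
      apply is_derive_Reals; auto_derive; [trivial|].
      change (match n with O => 1 | S _ => INR n + 1 end) with (INR (S n)).
      fold (u - a); unfold c; rewrite fact_simpl, mult_INR.
      field; split; [apply INR_fact_neq_0|now apply not_0_INR].
    - assert (taylor_g' := IH (fun k => g (S k)) (fun k => g_tower (S k))
                             (fun k => g_ge0 (S k)) u ltac:(lra)).
      cbv beta in taylor_g'; lra. }
  rewrite Rminus_diag, pow_ne_zero, Rmult_0_r in remainder_incr by discriminate.
  assert (0 <= g 0%nat a) by (apply g_ge0; lra).
  lra.
Qed.

Lemma exp_le_compat (x y : R) : x <= y -> exp x <= exp y.
Proof. intros [xy| ->]; [left; now apply exp_increasing|lra]. Qed.

Lemma exponential_barrier (g : nat -> R -> R) (A : nat -> R) (mu x y : R) (m : nat) :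
  derivative_tower g x y ->
  (forall n, (n < m)%nat -> A (S n) <= mu * A n) ->
  (forall n, (n < m)%nat -> - A n <= g n x) ->
  (forall t, x <= t <= y -> - (A m * exp (mu * (t - x))) <= g m t) ->
  forall n t, (n <= m)%nat -> x <= t <= y -> - (A n * exp (mu * (t - x))) <= g n t.
Proof.
intros g_tower A_growth g_start g_top.
assert (descent : forall d n, (n + d = m)%nat ->
          forall t, x <= t <= y -> - (A n * exp (mu * (t - x))) <= g n t).
{ induction d as [|d IH]; intros n nd_eq_m t t_in.
  - replace n with m by lia; now apply g_top.
  - assert (sum_incr : A n * exp (mu * (x - x)) + g n x
                       <= A n * exp (mu * (t - x)) + g n t).
    { apply derivable_pt_lim_nonneg_le with
        (f := fun u => A n * exp (mu * (u - x)) + g n u)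
        (f' := fun u => A n * (mu * exp (mu * (u - x))) + g (S n) u); [lra| |];
        intros u u_in.
      - apply (derivable_pt_lim_plus (fun v => A n * exp (mu * (v - x))));
          [|apply g_tower; lra].
        apply is_derive_Reals; auto_derive; [trivial|fold (u - x); ring].
      - assert (g_next := IH (S n) ltac:(lia) u ltac:(lra)).
        assert (A_next := A_growth n ltac:(lia)).
        assert (0 < exp (mu * (u - x))) by apply exp_pos.
        nra. }
    rewrite Rminus_diag, Rmult_0_r, exp_0, Rmult_1_r in sum_incr.
    assert (g_x := g_start n ltac:(lia)); lra. }
intros n t nm; apply (descent (m - n)%nat); lia.
Qed.

(** * Quasianalytic majorants *)

Definition log_convex (W : nat -> R) : Prop :=
  forall n, W (S n) ^ 2 <= W n * W (S (S n)).

Definition quasianalytic_majorant (W : nat -> R) : Prop :=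
  (forall p, 0 < W p) /\ log_convex W /\ quasianalytic W.

Lemma log_convex_ratio_le (W : nat -> R) (m n : nat) :
  (forall p, 0 < W p) -> log_convex W -> (m <= n)%nat ->
  W (S m) / W m <= W (S n) / W n.
Proof.
intros W_pos lcW mn; induction mn as [|n mn IH]; [lra|].
apply Rle_trans with (1 := IH).
apply Rle_div_l; [apply W_pos|].
replace (W (S (S n)) / W (S n) * W n) with (W n * W (S (S n)) / W (S n))
  by (field; apply Rgt_not_eq, W_pos).
apply Rle_div_r; [apply W_pos|].
assert (lcn := lcW n); lra.
Qed.

Lemma ratio_nonneg (W : nat -> R) (n : nat) :
  (forall p, 0 < W p) -> 0 <= W n / W (S n).
Proof. intros W_pos; left; apply Rdiv_lt_0_compat; apply W_pos. Qed.

Definition ratio_sum (W : nat -> R) : nat -> R := sum_f_R0 (fun k => W k / W (S k)).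

Lemma ratio_sum_le (W : nat -> R) (m n : nat) :
  (forall p, 0 < W p) -> (m <= n)%nat -> ratio_sum W m <= ratio_sum W n.
Proof.
intros W_pos mn; induction mn as [|n mn IH]; [lra|].
apply Rle_trans with (1 := IH); unfold ratio_sum; rewrite tech5.
assert (ratio_ge0 := ratio_nonneg W (S n) W_pos); lra.
Qed.

Lemma ratio_sum_shift_ge (W : nat -> R) (K n : nat) :
  (forall p, 0 < W p) ->
  ratio_sum W (n + K) - ratio_sum W K <= ratio_sum (fun k => W (k + K)%nat) n.
Proof.
intros W_pos; induction n as [|n IH].
- assert (ratio_ge0 := ratio_nonneg W K W_pos).
  unfold ratio_sum; simpl; lra.
- unfold ratio_sum in *; rewrite Nat.add_succ_l, !tech5.
  rewrite !Nat.add_succ_l; lra.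
Qed.

Lemma quasianalytic_majorant_shift (W : nat -> R) (K : nat) :
  quasianalytic_majorant W -> quasianalytic_majorant (fun n => W (n + K)%nat).
Proof.
intros (W_pos & lcW & qaW); split; [|split].
- intros p; apply W_pos.
- intros n; apply (lcW (n + K)%nat).
- intros B; destruct (qaW (B + ratio_sum W K)) as [L sum_L]; exists L.
  assert (tail_ge := ratio_sum_shift_ge W K L W_pos).
  assert (sum_le := ratio_sum_le W L (L + K) W_pos ltac:(lia)).
  change (B < ratio_sum (fun n => W (n + K)%nat) L).
  change (B + ratio_sum W K < ratio_sum W L) in sum_L; lra.
Qed.

Lemma quasianalytic_majorant_rescale (W : nat -> R) (C h : R) :
  0 < C -> 0 < h -> quasianalytic_majorant W ->
  quasianalytic_majorant (fun n => C * (h ^ n * W n)).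
Proof.
intros C_pos h_pos (W_pos & lcW & qaW); split; [|split].
- intros p; apply Rmult_lt_0_compat; [exact C_pos|].
  apply Rmult_lt_0_compat; [now apply pow_lt|apply W_pos].
- intros n.
  replace ((C * (h ^ S n * W (S n))) ^ 2)
    with ((C * h ^ S n) ^ 2 * W (S n) ^ 2) by ring.
  replace (C * (h ^ n * W n) * (C * (h ^ S (S n) * W (S (S n)))))
    with ((C * h ^ S n) ^ 2 * (W n * W (S (S n)))) by (simpl; ring).
  apply Rmult_le_compat_l; [apply pow2_ge_0|apply lcW].
- intros B; destruct (qaW (B * h)) as [n sum_n]; exists n.
  rewrite (sum_eq _ (fun k => W k / W (S k) * / h)).
  + rewrite <- scal_sum.
    apply Rmult_lt_reg_l with h; [exact h_pos|].
    rewrite <- Rmult_assoc, Rinv_r, Rmult_1_l by lra; lra.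
  + intros i _; assert (h_pow_pos := pow_lt h i h_pos); assert (Wi := W_pos (S i)).
    simpl; field; repeat split; lra.
Qed.

Lemma weight_sequence_majorant (M : nat -> R) :
  weight_sequence M -> quasianalytic M -> quasianalytic_majorant M.
Proof.
intros (M_pos & _ & _ & lcM & _) qaM; split; [exact M_pos|split; [|exact qaM]].
intros n; assert (lcn := lcM (S n) ltac:(lia)).
now rewrite Nat.sub_1_r, Nat.add_1_r in lcn.
Qed.

(** * Bang's argument for negative parts *)

Section Bang.

Variables (W : nat -> R) (g : nat -> R -> R) (a b : R).
Hypothesis W_majorant : quasianalytic_majorant W.
Hypothesis g_tower : derivative_tower g a b.
Hypothesis g_lower : forall n t, a <= t <= b -> - W n <= g n t.

Let W_pos : forall p, 0 < W p := proj1 W_majorant.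

Definition neg_bound (N : nat) (t : R) : Prop :=
  forall n, - (exp (INR n - INR N) * W n) <= g n t.

Lemma neg_bound_high_order (N n : nat) (t : R) :
  (N <= n)%nat -> a <= t <= b -> - (exp (INR n - INR N) * W n) <= g n t.
Proof.
intros Nn t_in; apply le_INR in Nn.
assert (1 <= exp (INR n - INR N)) by (rewrite <- exp_0; apply exp_le_compat; lra).
assert (Wn := W_pos n); assert (g_n := g_lower n t t_in); nra.
Qed.

Lemma exp_INR_S_minus (n N : nat) :
  exp (INR n - INR N) = exp 1 * exp (INR n - INR (S N)).
Proof. rewrite <- exp_plus, S_INR; f_equal; ring. Qed.

Lemma weighted_majorant_growth (N k : nat) (s : R) :
  (k <= N)%nat ->
  exp (INR (S k) - s) * W (S k)
  <= exp 1 * (W (S N) / W N) * (exp (INR k - s) * W k).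
Proof.
intros kN.
assert (ratio := log_convex_ratio_le W k N W_pos (proj1 (proj2 W_majorant)) kN).
apply (Rle_div_l _ _ _ (W_pos k)) in ratio.
replace (INR (S k) - s) with (1 + (INR k - s)) by (rewrite S_INR; ring).
rewrite exp_plus.
apply Rmult_le_compat_l with (r := exp 1 * exp (INR k - s)) in ratio;
  [lra|apply Rmult_le_pos; left; apply exp_pos].
Qed.

(* Integrating down from order [N+1] to order [n] inflates the bound at [x] by
   at most [exp (mu (y - x)) <= e], which is the factor lost from [N+1] to [N]. *)
Lemma neg_bound_step (N : nat) (x y : R) :
  a <= x -> x <= y -> y <= b -> exp 1 * (y - x) <= W N / W (S N) ->
  neg_bound (S N) x -> neg_bound N y.
Proof.
intros ax xy yb step_le nb_x n.
assert (e_pos := exp_pos 1); assert (WN := W_pos N); assert (WSN := W_pos (S N)).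
destruct (le_lt_dec N n) as [Nn|nN]; [apply neg_bound_high_order; lia || lra|].
set (A := fun k => exp (INR k - INR (S N)) * W k).
set (mu := exp 1 * (W (S N) / W N)).
assert (A_pos : forall k, 0 < A k)
  by (intros k; apply Rmult_lt_0_compat; [apply exp_pos|apply W_pos]).
assert (mu_pos : 0 < mu)
  by (apply Rmult_lt_0_compat; [|apply Rdiv_lt_0_compat]; lra).
assert (A_top : forall t, x <= t <= y ->
          - (A (S N) * exp (mu * (t - x))) <= g (S N) t).
{ intros t t_in.
  assert (1 <= exp (mu * (t - x))).
  { rewrite <- exp_0; apply exp_le_compat, Rmult_le_pos; lra. }
  assert (gSN := neg_bound_high_order (S N) (S N) t (le_n _) ltac:(lra)).
  fold (A (S N)) in gSN; assert (ASN := A_pos (S N)); nra. }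
assert (barrier := exponential_barrier g A mu x y (S N)
  (derivative_tower_subinterval g a b x y ax yb g_tower)
  (fun k kN => weighted_majorant_growth N k (INR (S N)) ltac:(lia))
  (fun k _ => nb_x k) A_top n y ltac:(lia) ltac:(lra)).
assert (exp (mu * (y - x)) <= exp 1).
{ apply exp_le_compat.
  replace (mu * (y - x)) with (exp 1 * (y - x) / (W N / W (S N)))
    by (unfold mu; field; lra).
  apply Rle_div_l; [apply Rdiv_lt_0_compat|]; lra. }
rewrite exp_INR_S_minus, Rmult_assoc; fold (A n).
assert (An := A_pos n); nra.
Qed.

Hypothesis g_nonneg_start : forall n, 0 <= g n a.

Lemma neg_bound_reach (d N : nat) (t : R) :
  a <= t <= b -> exp 1 * (t - a) <= ratio_sum W (N + d) - ratio_sum W N ->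
  neg_bound (S N) t.
Proof.
assert (e_pos := exp_pos 1).
revert N t; induction d as [|d IH]; intros N t t_ab t_reach.
- rewrite Nat.add_0_r, Rminus_diag in t_reach.
  assert (t = a) as -> by nra.
  intros n; assert (gn := g_nonneg_start n).
  assert (0 < exp (INR n - INR (S N)) * W n)
    by (apply Rmult_lt_0_compat; [apply exp_pos|apply W_pos]).
  lra.
- rewrite <- Nat.add_succ_comm in t_reach.
  set (q := (ratio_sum W (S N + d) - ratio_sum W (S N)) / exp 1).
  assert (q_ge0 : 0 <= q).
  { apply Rle_div_r; [lra|].
    assert (sum_le := ratio_sum_le W (S N) (S N + d) W_pos ltac:(lia)); lra. }
  assert (q_def : exp 1 * q = ratio_sum W (S N + d) - ratio_sum W (S N))
    by (unfold q; field; lra).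
  assert (sum_succ : ratio_sum W (S N) = ratio_sum W N + W (S N) / W (S (S N)))
    by reflexivity.
  assert (ratio_ge0 := ratio_nonneg W (S N) W_pos).
  assert (min_l := Rmin_l t (a + q)); assert (min_r := Rmin_r t (a + q)).
  assert (min_ge : a <= Rmin t (a + q)) by (apply Rmin_glb; lra).
  apply neg_bound_step with (x := Rmin t (a + q)); try lra.
  + unfold Rmin; destruct (Rle_dec t (a + q)); nra.
  + apply IH; [lra|nra].
Qed.

Lemma nonneg_of_neg_bounds (n : nat) (t : R) :
  (forall N, neg_bound (S N) t) -> 0 <= g n t.
Proof.
intros neg_bounds; apply Rnot_lt_le; intros g_neg.
assert (Wn := W_pos n).
set (ratio := - g n t / W n).
assert (ratio_pos : 0 < ratio) by (apply Rdiv_lt_0_compat; lra).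
destruct (INR_unbounded (INR n - ln ratio)) as [N N_large].
assert (exp (INR n - INR (S N)) < ratio).
{ rewrite <- (exp_ln ratio) by exact ratio_pos.
  apply exp_increasing; rewrite S_INR; lra. }
assert (nb_n := neg_bounds N n).
assert (ratio * W n = - g n t) by (unfold ratio; field; lra).
nra.
Qed.

Lemma quasianalytic_nonneg (n : nat) (t : R) : a <= t <= b -> 0 <= g n t.
Proof.
intros t_ab; apply nonneg_of_neg_bounds; intros N.
destruct (proj2 (proj2 W_majorant) (exp 1 * (t - a) + ratio_sum W N)) as [L sum_L].
change (exp 1 * (t - a) + ratio_sum W N < ratio_sum W L) in sum_L.
assert (sum_le := ratio_sum_le W L (N + L) W_pos ltac:(lia)).
apply (neg_bound_reach L); [exact t_ab|lra].
Qed.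

End Bang.

Lemma quasianalytic_coeff_big_O_pow (g : nat -> R -> R) (W : nat -> R) (a b : R)
    (K : nat) :
  quasianalytic_majorant W -> a < b -> derivative_tower g a b ->
  (forall n t, a <= t <= b -> - W n <= g n t) ->
  (forall n, (K <= n)%nat -> 0 <= g n a) ->
  big_O (fun n => g n a / INR (fact n)) (pow (/ (b - a))).
Proof.
intros W_maj ab g_tower g_lower g_start.
assert (len_pos : 0 < b - a) by lra.
assert (nonneg : forall n t, a <= t <= b -> 0 <= g (n + K)%nat t).
{ apply (quasianalytic_nonneg (fun n => W (n + K)%nat) (fun n => g (n + K)%nat)).
  - now apply quasianalytic_majorant_shift.
  - now apply derivative_tower_shift.
  - intros n t; apply g_lower.
  - intros n; apply g_start; lia. }
apply big_O_of_eventually with (C := g K b * (b - a) ^ K).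
{ intros n; apply pow_lt, Rinv_0_lt_compat, len_pos. }
exists K; intros n Kn.
assert (taylor := taylor_term_le (n - K) (fun k => g (k + K)%nat) a b
          (derivative_tower_shift g a b K g_tower) nonneg b ltac:(lra)).
cbv beta in taylor; rewrite Nat.sub_add, Nat.add_0_l in taylor by exact Kn.
assert (gn := g_start n Kn).
assert (fact_n := INR_fact_lt_0 n); assert (fact_m := INR_fact_lt_0 (n - K)).
assert (fact_le : INR (fact (n - K)) <= INR (fact n)) by (apply le_INR, fact_le; lia).
rewrite Rabs_pos_eq by (apply Rle_div_r; lra).
apply Rle_trans with (g n a / INR (fact (n - K))).
{ apply Rmult_le_compat_l; [exact gn|now apply Rinv_le_contravar]. }
apply Rle_div_r in taylor; [|now apply pow_lt].
apply Rle_trans with (1 := taylor); right.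
replace n with ((n - K) + K)%nat at 2 by lia.
rewrite pow_inv, pow_add; field; split; apply pow_nonzero; lra.
Qed.

(** * Growth of [n_k] *)

Definition mroot_unbounded (N : nat -> R) : Prop :=
  forall B, exists k, (1 <= k)%nat /\ B < mroot N k.

Definition mroot_diverges (N : nat -> R) : Prop :=
  forall B, exists K, forall k, (K <= k)%nat -> (1 <= k)%nat -> B < mroot N k.

Lemma mroot_diverges_unbounded (N : nat -> R) : mroot_diverges N -> mroot_unbounded N.
Proof.
intros N_diverges B; destruct (N_diverges B) as [K mroot_large].
exists (S K); split; [lia|apply mroot_large; lia].
Qed.

Lemma msmall_pos (N : nat -> R) (k : nat) : (forall p, 0 < N p) -> 0 < msmall N k.
Proof. intros N_pos; apply Rdiv_lt_0_compat; [apply N_pos|apply INR_fact_lt_0]. Qed.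

Lemma pow_mroot (N : nat -> R) (k : nat) :
  (forall p, 0 < N p) -> (1 <= k)%nat -> mroot N k ^ k = msmall N k.
Proof.
intros N_pos k_ge1; unfold mroot.
rewrite <- Rpower_pow by apply exp_pos.
rewrite Rpower_mult, Rinv_l by (apply not_0_INR; lia).
now apply Rpower_1, msmall_pos.
Qed.

Lemma pow_lt_compat_base (x y : R) (k : nat) :
  0 <= x < y -> (1 <= k)%nat -> x ^ k < y ^ k.
Proof.
intros xy k_ge1; induction k_ge1 as [|k k_ge1 IH]; simpl; [lra|].
apply Rmult_le_0_lt_compat; try lra; apply pow_le; lra.
Qed.

Lemma pow_lt_msmall (N : nat -> R) (B : R) (k : nat) :
  (forall p, 0 < N p) -> (1 <= k)%nat -> 0 <= B < mroot N k -> B ^ k < msmall N k.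
Proof.
intros N_pos k_ge1 B_lt; rewrite <- pow_mroot by assumption.
now apply pow_lt_compat_base.
Qed.

Lemma msmall_not_big_O_pow (N : nat -> R) (A : R) :
  (forall p, 0 < N p) -> mroot_unbounded N -> ~ big_O (msmall N) (pow A).
Proof.
intros N_pos N_unbounded [C [C_ge0 N_le]].
destruct (N_unbounded ((C + 1) * Rabs A)) as [k [k_ge1 mroot_large]].
assert (A_abs := Rabs_pos A).
assert (N_gt := pow_lt_msmall N ((C + 1) * Rabs A) k N_pos k_ge1 ltac:(split; nra)).
assert (C_pow : C <= (C + 1) ^ k).
{ apply Rle_trans with ((C + 1) ^ 1); [|apply Rle_pow; [|exact k_ge1]]; lra. }
assert (A_pow : A ^ k <= Rabs A ^ k) by (rewrite RPow_abs; apply Rle_abs).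
apply Rmult_le_compat_l with (r := C) in A_pow; [|exact C_ge0].
apply Rmult_le_compat_r with (r := Rabs A ^ k) in C_pow; [|now apply pow_le].
specialize (N_le k); rewrite Rpow_mult_distr in N_gt.
assert (N_abs := Rle_abs (msmall N k)); lra.
Qed.

Lemma pow_big_O_msmall (N : nat -> R) (B : R) :
  (forall p, 0 < N p) -> mroot_diverges N -> 0 <= B -> big_O (pow B) (msmall N).
Proof.
intros N_pos N_diverges B_ge0.
apply (big_O_of_eventually _ _ 1); [intros k; now apply msmall_pos|].
destruct (N_diverges B) as [K mroot_large]; exists (S K); intros k K_lt_k.
rewrite Rmult_1_l, Rabs_pos_eq by now apply pow_le.
left; apply pow_lt_msmall; [exact N_pos|lia|].
split; [exact B_ge0|apply mroot_large; lia].
Qed.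

Lemma sqrt_msmall_not_big_O_pow (N : nat -> R) (A : R) :
  (forall p, 0 < N p) -> mroot_unbounded N ->
  ~ big_O (fun k => sqrt (msmall N k)) (pow A).
Proof.
intros N_pos N_unbounded sqrt_O.
apply (msmall_not_big_O_pow N (A * A) N_pos N_unbounded).
assert (prod_O := big_O_mult _ _ _ _ sqrt_O sqrt_O).
replace (pow (A * A)) with (fun k => A ^ k * A ^ k)
  by (apply functional_extensionality; intros k; now rewrite Rpow_mult_distr).
replace (msmall N) with (fun k => sqrt (msmall N k) * sqrt (msmall N k));
  [exact prod_O|].
apply functional_extensionality; intros k.
now apply sqrt_sqrt, Rlt_le, msmall_pos.
Qed.

Lemma pow_mul_sqrt_msmall_big_O (N : nat -> R) (Q h : R) :
  (forall p, 0 < N p) -> mroot_diverges N -> 0 < h ->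
  big_O (fun k => Q ^ k * sqrt (msmall N k)) (fun k => h ^ k * msmall N k).
Proof.
intros N_pos N_diverges h_pos.
assert (ratio_O : big_O (pow (Q / h)) (fun k => sqrt (msmall N k))).
{ apply big_O_sqrt.
  replace (fun k => ((Q / h) ^ k) ^ 2) with (pow ((Q / h) ^ 2)).
  - apply pow_big_O_msmall; [exact N_pos|exact N_diverges|apply pow2_ge_0].
  - apply functional_extensionality; intros k.
    now rewrite <- !pow_mult, Nat.mul_comm. }
assert (weight_O : big_O (fun k => h ^ k * sqrt (msmall N k))
                         (fun k => h ^ k * sqrt (msmall N k))).
{ apply big_O_refl; intros k; apply Rmult_le_pos; [apply pow_le; lra|apply sqrt_pos]. }
destruct (big_O_mult _ _ _ _ ratio_O weight_O) as [C [C_ge0 prod_le]].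
exists C; split; [exact C_ge0|]; intros k; specialize (prod_le k).
replace (h ^ k * msmall N k)
  with (sqrt (msmall N k) * (h ^ k * sqrt (msmall N k))).
- replace (Q ^ k * sqrt (msmall N k))
    with ((Q / h) ^ k * (h ^ k * sqrt (msmall N k))); [exact prod_le|].
  unfold Rdiv; rewrite Rpow_mult_distr, pow_inv; field; now apply Rgt_not_eq, pow_lt.
- assert (sqrt_N := sqrt_sqrt (msmall N k) (Rlt_le _ _ (msmall_pos N k N_pos))).
  rewrite <- sqrt_N at 3; ring.
Qed.

(** * Lineability *)

Lemma lincomb_eq_vzero {T : Type} (c : nat -> R) (v : nat -> T -> R) (n : nat) :
  (forall i, (i < n)%nat -> c i = 0) -> lincomb c v n = vzero.
Proof.
induction n as [|n IH]; intros c_eq0; [reflexivity|].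
simpl; rewrite IH, c_eq0 by auto.
apply functional_extensionality; intros t; unfold vzero; ring.
Qed.

Lemma lincomb_extend {T : Type} (c : nat -> R) (v : nat -> T -> R) (m n : nat) :
  (m <= n)%nat -> (forall i, (m <= i)%nat -> c i = 0) -> lincomb c v n = lincomb c v m.
Proof.
intros mn c_eq0; induction mn as [|n mn IH]; [reflexivity|].
simpl; rewrite IH, c_eq0 by exact mn.
apply functional_extensionality; intros t; ring.
Qed.

Lemma lincomb_plus {T : Type} (c c' : nat -> R) (v : nat -> T -> R) (n : nat) (t : T) :
  lincomb (fun i => c i + c' i) v n t = lincomb c v n t + lincomb c' v n t.
Proof. induction n as [|n IH]; simpl; [unfold vzero; ring|rewrite IH; ring]. Qed.

Lemma lincomb_scal {T : Type} (a : R) (c : nat -> R) (v : nat -> T -> R)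
    (n : nat) (t : T) :
  lincomb (fun i => a * c i) v n t = a * lincomb c v n t.
Proof. induction n as [|n IH]; simpl; [unfold vzero; ring|rewrite IH; ring]. Qed.

Lemma lincomb_delta {T : Type} (v : nat -> T -> R) (i : nat) :
  lincomb (fun j => if Nat.eqb j i then 1 else 0) v (S i) = v i.
Proof.
simpl; rewrite lincomb_eq_vzero, Nat.eqb_refl.
- apply functional_extensionality; intros t; unfold vzero; ring.
- intros j ji; destruct (Nat.eqb_spec j i); [lia|reflexivity].
Qed.

Definition finite_span {T : Type} (v : nat -> T -> R) (u : T -> R) : Prop :=
  exists c n, (forall i, (n <= i)%nat -> c i = 0) /\ u = lincomb c v n.

Lemma finite_span_generator {T : Type} (v : nat -> T -> R) (i : nat) :
  finite_span v (v i).
Proof.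
exists (fun j => if Nat.eqb j i then 1 else 0), (S i); split.
- intros j ij; destruct (Nat.eqb_spec j i); [lia|reflexivity].
- now rewrite lincomb_delta.
Qed.

Lemma finite_span_subspace {T : Type} (v : nat -> T -> R) :
  is_subspace (finite_span v).
Proof.
split; [|split].
- now exists (fun _ => 0), 0%nat.
- intros u u' [c [n [c_eq0 ->]]] [c' [n' [c'_eq0 ->]]].
  exists (fun i => c i + c' i), (n + n')%nat; split.
  + intros i i_ge; rewrite c_eq0, c'_eq0 by lia; ring.
  + apply functional_extensionality; intros t.
    now rewrite lincomb_plus, (lincomb_extend c v n (n + n')),
      (lincomb_extend c' v n' (n + n')) by (assumption || lia).
- intros a u [c [n [c_eq0 ->]]].
  exists (fun i => a * c i), n; split.
  + intros i i_ge; rewrite c_eq0 by exact i_ge; ring.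
  + apply functional_extensionality; intros t; now rewrite lincomb_scal.
Qed.

Lemma lineable_of_nontrivial_lincombs {T : Type} (v : nat -> T -> R)
    (L : (T -> R) -> Prop) :
  ~ L vzero ->
  (forall c n, (exists i, (i < n)%nat /\ c i <> 0) -> L (lincomb c v n)) ->
  lineable L.
Proof.
intros L_zero L_lincomb; exists (finite_span v).
split; [apply finite_span_subspace|split].
- intros n; exists v; split; [intros i _; apply finite_span_generator|].
  intros c c_dep i i_lt_n; apply NNPP; intros ci.
  apply L_zero; rewrite <- c_dep; apply L_lincomb; now exists i.
- intros u [c [n [_ ->]]].
  destruct (classic (exists i, (i < n)%nat /\ c i <> 0)) as [nonzero|all_zero];
    [left; now apply L_lincomb|right].
  apply lincomb_eq_vzero; intros i i_lt_n; apply NNPP; intros ci.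
  apply all_zero; now exists i.
Qed.

(** * Restriction of germs to the first coordinate axis *)

Lemma quant_h_imp (roum : bool) (P Q : R -> Prop) :
  (forall h, 0 < h -> P h -> Q h) -> quant_h roum P -> quant_h roum Q.
Proof.
destruct roum; simpl; intros PQ; [|now auto].
intros [h [h_pos Ph]]; exists h; auto.
Qed.

Lemma quant_h_roumieu (roum : bool) (P : R -> Prop) :
  quant_h roum P -> quant_h true P.
Proof.
destruct roum; [easy|]; intros all_h.
exists 1; split; [lra|apply all_h; lra].
Qed.

Lemma in_jet_image_roumieu (r : nat) (M : nat -> R) (roum : bool) (b : mindex r -> R) :
  in_jet_image r M roum b -> in_jet_image r M true b.
Proof.
intros [k [D [(k_ge1 & smooth_D & D_bound) jet_D]]]; exists k, D.
split; [|exact jet_D]; split; [exact k_ge1|split; [exact smooth_D|]].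
intros rho rho_lt; exact (quant_h_roumieu roum _ (D_bound rho rho_lt)).
Qed.

Lemma in_jet_image_vzero (r : nat) (M : nat -> R) (roum : bool) :
  in_jet_image r M roum vzero.
Proof.
exists 1%nat, (fun _ _ => 0); split; [split; [lia|split; [split|]]|].
- intros a _ i _ x _; apply derivable_pt_lim_const.
- intros a _ x _ eps eps_pos; exists 1; split; [lra|]; intros y _ _.
  now rewrite Rminus_diag, Rabs_R0.
- intros rho _.
  assert (zero_bound : forall h, exists C, forall a, valid_mi r a ->
            forall x, closed_cube r rho x ->
            Rabs 0 <= C * (h ^ mabs r a * M (mabs r a))).
  { intros h; exists 0; intros a _ x _; rewrite Rabs_R0; lra. }
  destruct roum; simpl; [exists 1; split; [lra|]|intros h _]; apply zero_bound.
- apply functional_extensionality; intros al; unfold jet, vzero, Rdiv; ring.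
Qed.

Definition axis (k : nat) : nat -> nat := fun j => if Nat.eqb j 0 then k else 0%nat.

Definition axis_point (t : R) : nat -> R := upd zero_pt 0 t.

Lemma incr_axis (k : nat) : incr (axis k) 0 = axis (S k).
Proof.
apply functional_extensionality; intros j; unfold incr, axis.
now destruct (Nat.eqb j 0).
Qed.

Lemma upd_axis_point (t v : R) : upd (axis_point t) 0 v = axis_point v.
Proof.
apply functional_extensionality; intros j; unfold axis_point, upd.
now destruct (Nat.eqb j 0).
Qed.

Lemma axis_point_0 : axis_point 0 = zero_pt.
Proof.
apply functional_extensionality; intros j; unfold axis_point, upd, zero_pt.
now destruct (Nat.eqb j 0).
Qed.

Section AxisRestriction.

Variable r : nat.
Hypothesis r_ge1 : (1 <= r)%nat.

Lemma axis_valid (k : nat) : valid_mi r (axis k).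
Proof.
intros i r_le_i; unfold axis; destruct (Nat.eqb_spec i 0); [lia|reflexivity].
Qed.

Definition axis_index (k : nat) : mindex r := exist _ (axis k) (axis_valid k).

Lemma mabs_axis (k : nat) : mabs r (axis k) = k.
Proof.
unfold mabs; induction r_ge1 as [|n n_ge1 IH]; [reflexivity|].
simpl; rewrite IH; unfold axis; destruct (Nat.eqb_spec n 0); lia.
Qed.

Lemma axis_point_open_cube (rho t : R) :
  Rabs t < rho -> open_cube r rho (axis_point t).
Proof.
intros t_lt i; assert (t_abs := Rabs_pos t); unfold axis_point, upd, zero_pt.
destruct (Nat.eqb_spec i 0); split; intros i_side; try lia; try reflexivity;
  [exact t_lt|].
rewrite Rabs_R0; lra.
Qed.

Lemma open_cube_closed_cube (rho : R) (x : nat -> R) :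
  open_cube r rho x -> closed_cube r rho x.
Proof. intros x_in i; split; [left; now apply x_in|apply x_in]. Qed.

Lemma smooth_derivs_axis_tower (rho a b : R)
    (D : (nat -> nat) -> (nat -> R) -> R) :
  smooth_derivs r rho D -> - rho < a -> b < rho ->
  derivative_tower (fun n t => D (axis n) (axis_point t)) a b.
Proof.
intros [D_partial _] rho_a b_rho n t t_in.
assert (D_deriv := D_partial (axis n) (axis_valid n) 0%nat ltac:(lia) (axis_point t)
                     (axis_point_open_cube rho t ltac:(apply Rabs_def1; lra))).
rewrite incr_axis in D_deriv.
apply derivable_pt_lim_ext with (2 := D_deriv).
intros v; now rewrite upd_axis_point.
Qed.

Lemma germ_axis_majorant (k : nat) (M : nat -> R)
    (D : (nat -> nat) -> (nat -> R) -> R) :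
  quasianalytic_majorant M -> germ_class r M true k D ->
  exists rho W, 0 < rho /\ quasianalytic_majorant W /\
    derivative_tower (fun n t => D (axis n) (axis_point t)) 0 rho /\
    forall n t, 0 <= t <= rho -> Rabs (D (axis n) (axis_point t)) <= W n.
Proof.
intros M_maj (k_ge1 & smooth_D & D_bound).
set (side := / INR k) in *.
assert (side_pos : 0 < side) by (apply Rinv_0_lt_compat, lt_0_INR; lia).
destruct (D_bound (side / 2) ltac:(lra)) as [h [h_pos [C D_le]]].
exists (side / 3), (fun n => (Rabs C + 1) * (h ^ n * M n)).
assert (C_abs := Rabs_pos C); split; [lra|split; [|split]].
- apply quasianalytic_majorant_rescale; lra || assumption.
- apply (smooth_derivs_axis_tower side); [exact smooth_D|lra|lra].
- intros n t t_in.
  specialize (D_le (axis n) (axis_valid n) (axis_point t)).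
  rewrite mabs_axis in D_le.
  apply Rle_trans with (C * (h ^ n * M n)).
  + apply D_le, open_cube_closed_cube, axis_point_open_cube, Rabs_def1; lra.
  + apply Rmult_le_compat_r; [|assert (C_le := Rle_abs C); lra].
    apply Rmult_le_pos; [apply pow_le; lra|left; apply M_maj].
Qed.

Lemma jet_axis (D : (nat -> nat) -> (nat -> R) -> R) (n : nat) :
  jet r D (axis_index n) = D (axis n) (axis_point 0) / INR (fact n).
Proof. unfold jet; simpl; now rewrite mabs_axis, axis_point_0. Qed.

Lemma jet_image_axis_big_O_pow (M : nat -> R) (b : mindex r -> R) (s : R) (K : nat) :
  quasianalytic_majorant M -> in_jet_image r M true b -> Rabs s = 1 ->
  (forall n, (K <= n)%nat -> 0 <= s * b (axis_index n)) ->
  exists A, 0 < A /\ big_O (fun n => s * b (axis_index n)) (pow A).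
Proof.
intros M_maj [k [D [germ_D ->]]] s_abs b_sign.
destruct (germ_axis_majorant k M D M_maj germ_D)
  as [rho [W [rho_pos [W_maj [D_tower D_le]]]]].
assert (coeff : forall n, s * jet r D (axis_index n)
                          = s * D (axis n) (axis_point 0) / INR (fact n)).
{ intros n; rewrite jet_axis; unfold Rdiv; ring. }
exists (/ (rho - 0)); split; [apply Rinv_0_lt_compat; lra|].
rewrite (functional_extensionality _ _ coeff).
apply (quasianalytic_coeff_big_O_pow (fun n t => s * D (axis n) (axis_point t)) W
         0 rho K W_maj rho_pos).
- now apply (derivative_tower_scal (fun n t => D (axis n) (axis_point t))).
- intros n t t_in.
  assert (D_abs := D_le n t t_in).
  rewrite <- (Rmult_1_l (Rabs _)), <- s_abs, <- Rabs_mult in D_abs.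
  apply Rabs_le_between in D_abs; lra.
- intros n K_le_n; specialize (b_sign n K_le_n); rewrite coeff in b_sign.
  assert (fact_pos := INR_fact_lt_0 n).
  apply Rle_div_r in b_sign; lra.
Qed.

(* For [r >= 1], the multi-indices with [|a| = a_0] are exactly the multiples
   of [e_1]. *)
Definition axis_seq (u : nat -> R) : mindex r -> R :=
  fun al => let a := proj1_sig al in
    if Nat.eqb (mabs r a) (a 0%nat) then u (a 0%nat) else 0.

Lemma axis_seq_index (u : nat -> R) (n : nat) : axis_seq u (axis_index n) = u n.
Proof.
unfold axis_seq; simpl; rewrite mabs_axis.
unfold axis; simpl; now rewrite Nat.eqb_refl.
Qed.

Lemma lincomb_axis_seq (c : nat -> R) (u : nat -> nat -> R) (n : nat) :
  lincomb c (fun i => axis_seq (u i)) n = axis_seq (lincomb c u n).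
Proof.
apply functional_extensionality; intros al; unfold axis_seq.
destruct (Nat.eqb _ _) eqn:on_axis; induction n as [|n IH]; simpl; unfold vzero;
  try reflexivity; rewrite IH, on_axis; ring.
Qed.

Lemma axis_seq_Lambda (N u : nat -> R) (roum : bool) :
  (forall p, 0 < N p) ->
  quant_h roum (fun h => big_O u (fun k => h ^ k * msmall N k)) ->
  Lambda r N roum (axis_seq u).
Proof.
intros N_pos; apply quant_h_imp; intros h h_pos [C [C_ge0 u_le]].
exists C; intros al; unfold axis_seq.
destruct (Nat.eqb_spec (mabs r (proj1_sig al)) (proj1_sig al 0%nat)) as [->|ne];
  [apply u_le|].
rewrite Rabs_R0; apply Rmult_le_pos; [exact C_ge0|].
apply Rmult_le_pos; [apply pow_le; lra|left; now apply msmall_pos].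
Qed.

Lemma axis_seq_not_jet (M v f : nat -> R) (c : R) :
  quasianalytic_majorant M -> (forall k, 0 < v k) -> c <> 0 ->
  is_equiv eventually f (fun k => c * v k) -> (forall A, ~ big_O v (pow A)) ->
  ~ in_jet_image r M true (axis_seq f).
Proof.
intros M_maj v_pos c_neq0 equiv_f v_large jet_f.
assert (c_pos : 0 < Rabs c) by now apply Rabs_pos_lt.
destruct (is_equiv_eventual_sign f v c v_pos c_neq0 equiv_f) as [K f_sign].
destruct (jet_image_axis_big_O_pow M (axis_seq f) (sign c) K M_maj jet_f)
  as [A [A_pos [C [C_ge0 f_le]]]].
- destruct (Rdichotomy c 0 c_neq0).
  + rewrite sign_eq_m1, Rabs_left; lra.
  + rewrite sign_eq_1, Rabs_R1; lra.
- intros n K_le_n; rewrite axis_seq_index; apply Rle_trans with (2 := f_sign n K_le_n).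
  apply Rmult_le_pos; [lra|left; apply v_pos].
- apply (v_large A), big_O_of_eventually with (C := C / (Rabs c / 2)).
  { intros n; now apply pow_lt. }
  exists K; intros n K_le_n; specialize (f_sign n K_le_n); specialize (f_le n).
  rewrite axis_seq_index in f_le; rewrite Rabs_pos_eq by (left; apply v_pos).
  replace (C / (Rabs c / 2) * A ^ n) with (C * A ^ n / (Rabs c / 2)) by (field; lra).
  apply Rle_div_r; [lra|].
  assert (f_abs := Rle_abs (sign c * f n)); lra.
Qed.

Lemma lineable_axis_scale (M N : nat -> R) (u : nat -> nat -> R) (roum roum' : bool) :
  quasianalytic_majorant M -> (forall p, 0 < N p) -> asymptotic_scale u ->
  (forall i, quant_h roum (fun h => big_O (u i) (fun k => h ^ k * msmall N k))) ->
  (forall i A, ~ big_O (u i) (pow A)) ->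
  lineable (fun b => Lambda r N roum b /\ ~ in_jet_image r M roum' b).
Proof.
intros M_maj N_pos u_scale u_small u_large.
apply (lineable_of_nontrivial_lincombs (fun i => axis_seq (u i))).
{ intros [_ zero_not_jet]; apply zero_not_jet, in_jet_image_vzero. }
intros c n c_neq0; rewrite lincomb_axis_seq; split.
- apply axis_seq_Lambda; [exact N_pos|].
  apply quant_h_imp with (2 := u_small n); intros h _; apply big_O_trans.
  apply is_domin_big_O; [apply u_scale|now apply asymptotic_scale_domin_lincomb].
- intros jet_lincomb.
  destruct (asymptotic_scale_equiv_lincomb u c n u_scale c_neq0) as [i [ci equiv_i]].
  apply (axis_seq_not_jet M (u i) (lincomb c u n) (c i)); auto.
  + apply u_scale.
  + now apply in_jet_image_roumieu with roum'.
Qed.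

Lemma lineable_roumieu (M N : nat -> R) (roum' : bool) :
  quasianalytic_majorant M -> (forall p, 0 < N p) -> mroot_unbounded N ->
  lineable (fun b => Lambda r N true b /\ ~ in_jet_image r M roum' b).
Proof.
intros M_maj N_pos N_unbounded.
assert (n_pos : forall k, 0 < msmall N k) by (intros k; now apply msmall_pos).
apply (lineable_axis_scale M N (geometric_scale (msmall N))); auto.
- now apply geometric_scale_asymptotic.
- intros i; exists (2 ^ i); split; [apply pow_lt; lra|].
  apply big_O_refl; intros k; left; now apply geometric_scale_pos.
- intros i A; now apply geometric_scale_not_big_O_pow, msmall_not_big_O_pow.
Qed.

Lemma lineable_beurling (M N : nat -> R) (roum' : bool) :
  quasianalytic_majorant M -> (forall p, 0 < N p) -> mroot_diverges N ->
  lineable (fun b => Lambda r N false b /\ ~ in_jet_image r M roum' b).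
Proof.
intros M_maj N_pos N_diverges.
assert (sqrt_n_pos : forall k, 0 < sqrt (msmall N k))
  by (intros k; now apply sqrt_lt_R0, msmall_pos).
apply (lineable_axis_scale M N (geometric_scale (fun k => sqrt (msmall N k)))); auto.
- now apply geometric_scale_asymptotic.
- intros i h h_pos; now apply pow_mul_sqrt_msmall_big_O.
- intros i A.
  now apply geometric_scale_not_big_O_pow, sqrt_msmall_not_big_O_pow,
    mroot_diverges_unbounded.
Qed.

End AxisRestriction.

Theorem mainTheorem7 (r : nat) (M N : nat -> R) :
  (1 <= r)%nat ->
  weight_sequence M -> weight_sequence N ->
  quasianalytic M -> quasianalytic N ->
  (* Roumieu case *)
  ((forall B : R, exists k : nat, (1 <= k)%nat /\ B < mroot N k) ->
     lineable (fun b => Lambda r N true b /\ ~ in_jet_image r M true b) /\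
     lineable (fun b => Lambda r N true b /\ ~ in_jet_image r M false b)) /\
  (* Beurling case *)
  ((forall B : R, exists K : nat, forall k : nat, (K <= k)%nat -> (1 <= k)%nat ->
        B < mroot N k) ->
     lineable (fun b => Lambda r N false b /\ ~ in_jet_image r M true b) /\
     lineable (fun b => Lambda r N false b /\ ~ in_jet_image r M false b)).
Proof.
intros r_ge1 M_weight [N_pos _] M_qa _.
assert (M_maj := weight_sequence_majorant M M_weight M_qa).
split; intros N_growth; split.
- now apply lineable_roumieu.
- now apply lineable_roumieu.
- now apply lineable_beurling.
- now apply lineable_beurling.
Qed.
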